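(* Let $G$ be a graph with $n$ vertices and maximum degree $\Delta$. Then \[\gamma_{ir}(G) \geq \max \left\{ \left \lceil \frac{n}{2} \right \rceil , \, n- \Delta \right\}.\] Moreover, the bound is sharp: there exist graphs for which equality holds.
   Context: All graphs are finite, simple, undirected and have at least one vertex. $N(v)$ denotes the set of neighbours of a vertex $v$. A dominating set of $G$ is a set $D \subseteq V(G)$ such that every vertex in $V(G)\setminus D$ has a neighbour in $D$. An irregular dominating set of $G$ is a dominating set $D$ of $G$ such that $|N(u) \cap D| \neq |N(v) \cap D|$ for every two distinct vertices $u, v \in V(G) \setminus D$ (in particular, $V(G)$ is one). The irregular domination number $\gamma_{ir}(G)$ is the size of a smallest irregular dominating set of $G$. *)

(* Defs.v *)
From mathcomp Require Import all_boot.
Set Implicit Arguments.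
Unset Strict Implicit.
Unset Printing Implicit Defensive.

Record sgraph := SGraph {
  vertex :> finType;
  adj : rel vertex;
  adj_sym : symmetric adj;
  adj_irrefl : irreflexive adj;
  vertex_gt0 : 0 < #|vertex|
}.

Section IrregularDomination.
Variable G : sgraph.

Definition neighbours (v : G) : {set G} := [set u | adj v u].

Definition max_degree : nat := \max_(v : G) #|neighbours v|.

Definition dominating (D : {set G}) : bool :=
  [forall v in ~: D, exists u in D, adj v u].

Definition irregular_dominating (D : {set G}) : bool :=
  dominating D &&
  [forall u in ~: D, forall v in ~: D,
    (u != v) ==> (#|neighbours u :&: D| != #|neighbours v :&: D|)].

(* [arg min_] is only meaningful when its base point satisfies the predicate. *)
Lemma irregular_dominatingT : irregular_dominating setT.
Proof.
by apply/andP; split; apply/forall_inP => v; rewrite setCT inE.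
Qed.

Definition gamma_ir : nat :=
  #|[arg min_(D < [set: G] | irregular_dominating D) #|D|]|.

End IrregularDomination.

(* Main.v *)
(** Outside an irregular dominating set [D], the map sending [v] to
    [#|N(v) :&: D|] is injective and takes positive values bounded both by [#|D|]
    and by the maximum degree; hence [n - #|D|] is at most each of these two
    numbers. The complete graph on two vertices attains the bound. *)
Require Import Defs.
From mathcomp Require Import all_boot.

(** [k] is kept abstract to serve both for [#|D|] and for the maximum degree. *)
Lemma irregular_dominating_card_setC (G : sgraph) (D : {set G}) (k : nat) :
    irregular_dominating D ->
    (forall v, #|neighbours v :&: D| <= k) ->
  #|~: D| <= k.
Proof.
case/andP=> /forall_inP domD /forall_inP irrD le_k.
pose f v := #|neighbours v :&: D|.
(* Pigeonhole: the values of [f] outside [D] lie in [1..k]; the range starts at 1 because [D]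
   dominates. *)
rewrite cardE -(size_map f) -(size_iota 1 k); apply: uniq_leq_size.
  rewrite map_inj_in_uniq ?enum_uniq // => u v.
  rewrite !mem_enum => uD vD eq_f; apply/eqP; apply: contraT => neq_uv.
  by have /forall_inP/(_ v vD) := irrD u uD; rewrite neq_uv -/(f u) eq_f eqxx.
move=> _ /mapP[v + ->]; rewrite mem_enum mem_iota add1n ltnS le_k andbT.
move=> /domD /exists_inP[u uD adj_vu].
by apply/card_gt0P; exists u; rewrite !inE adj_vu.
Qed.

Lemma gamma_ir_le (G : sgraph) (D : {set G}) :
  irregular_dominating D -> gamma_ir G <= #|D|.
Proof.
move=> irrD; rewrite /gamma_ir.
by case: arg_minnP => [|E _]; [exact: irregular_dominatingT | exact].
Qed.

Lemma gamma_ir_ge (G : sgraph) :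
  maxn (uphalf #|G|) (#|G| - max_degree G) <= gamma_ir G.
Proof.
rewrite /gamma_ir; case: arg_minnP => [|D irrD _].
  exact: irregular_dominatingT.
(* Splitting [#|G|] as [#|D| + #|~: D|] turns both bounds into upper bounds on [#|~: D|]. *)
rewrite geq_max leq_uphalf_double -addnn leq_subLR -(cardsC D).
rewrite leq_add2l addnC leq_add2r; apply/andP; split.
  apply: irregular_dominating_card_setC => // v.
  exact/subset_leq_card/subsetIr.
apply: irregular_dominating_card_setC => // v.
apply: leq_trans (subset_leq_card (subsetIl _ _)) _.
exact: (leq_bigmax (F := fun v => #|neighbours v|)).
Qed.

(** Transparent, so that vertices of [K2] reduce to booleans. *)
Definition K2 : sgraph.
Proof.
by refine (@SGraph bool (fun x y => x != y) _ _ _);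
  [case=> [] [] | case | rewrite card_bool].
Defined.

Lemma irregular_dominating_K2 : @irregular_dominating K2 [set true].
Proof.
apply/andP; split; apply/forall_inP => v; rewrite !inE.
  by case: v => // _; apply/exists_inP; exists true; rewrite ?inE.
(* Only [false] lies outside, so there is no distinct pair to compare. *)
by case: v => // _; apply/forall_inP => v; rewrite !inE; case: v.
Qed.

Theorem theorem4p1 :
  (forall G : sgraph,
     gamma_ir G >= maxn (uphalf #|G|) (#|G| - max_degree G)) /\
  (exists G : sgraph,
     gamma_ir G = maxn (uphalf #|G|) (#|G| - max_degree G)).
Proof.
split; first exact: gamma_ir_ge.
exists K2; apply/eqP; rewrite eqn_leq gamma_ir_ge andbT.
apply: leq_trans (gamma_ir_le _ _ irregular_dominating_K2) _.
(* The term [uphalf 2 = 1] already reaches the size of [[set true]]. *)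
by rewrite cards1 leq_max card_bool.
Qed.
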